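(* Let $\mathcal{U}$ be a complete subcategory of $\mathcal{G}$. Then any object of $\mathcal{A}\mathcal{U}$ with a finite (i.e. finite length) projective resolution is projective. In particular any perfect object is finitely projective.
   Context: Fix a field $k$ of characteristic zero. $\mathcal{G}$ is the category whose objects are finite groups and whose morphisms are conjugacy classes of surjective group homomorphisms. A subcategory of $\mathcal{G}$ is always full and replete. For $\mathcal{U}\le\mathcal{G}$, $\mathcal{A}\mathcal{U}=[\mathcal{U}^{\mathrm{op}},\mathrm{Vect}_k]$; for $G\in\mathcal{U}$, $e_G(T)=k[\mathcal{U}(T,G)]$. For a finite group $T$, $\delta(T)$ is the minimum possible size of a generating set for $T$. For $m\in\mathbb{N}$ put $\mathcal{R}_m=\{T\in\mathcal{U}\mid\delta(T)\ge m\}$. $\mathcal{U}$ is expansive if for all $G\in\mathcal{U}$ and $m\in\mathbb{N}$ there exists $T\in\mathcal{R}_m$ with $\mathcal{U}(T,G)\neq\emptyset$. For $\mathcal{U}$ expansive, $X\in\mathcal{A}\mathcal{U}$ and an integer $n>0$ put $\omega_n^{\mathcal{U}}(X)=\lim_{m\to\infty}\sup\{\dim(X(T))/n^{\delta(T)}\mid T\in\mathcal{R}_m\}\in[0,\infty]$. $\mathcal{U}$ is complete if it is expansive and for all $n>0$ and all $G\in\mathcal{U}$ with $|G|=n$ we have $0<\omega_n^{\mathcal{U}}(e_G)<\infty$. An object is finitely projective if it can be expressed as the direct sum of a finite family of indecomposable projectives. An object $X$ is perfect if there is a resolution $P_*\to X$ with every $P_i$ finitely projective and $P_i=0$ for $i\gg0$.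 *)

(* Defs.v *)
From HB Require Import structures.
From mathcomp Require Import all_boot all_order all_algebra all_fingroup all_solvable.
From mathcomp Require Import generic_quotient.
From mathcomp Require Import boolp classical_sets reals ereal topology.
From mathcomp Require Import normedtype sequences.
Set Implicit Arguments.
Unset Strict Implicit.
Unset Printing Implicit Defensive.
Import GRing.Theory.
Import numFieldNormedType.Exports.
Local Open Scope ring_scope.
Local Open Scope quotient_scope.

Section OuterHom.
Variables G H : finGroupType.

Definition is_epi (f : {ffun G -> H}) : bool :=
  morphic [set: G] f && (f @: [set: G] == [set: H]).

Record epi := Epi { epi_fun :> {ffun G -> H}; _ : is_epi epi_fun }.
HB.instance Definition _ := [isSub for epi_fun].
HB.instance Definition _ := [Finite of epi by <:].

Definition conj_epi (f g : epi) : bool :=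
  [exists h : H, [forall x : G, f x == (g x ^ h)%g]].

Lemma conj_epi_refl : reflexive conj_epi.
Proof.
move=> f; apply/existsP; exists 1%g.
by apply/forallP => x; rewrite conjg1.
Qed.

Lemma conj_epi_sym : symmetric conj_epi.
Proof.
have imp f g : conj_epi f g -> conj_epi g f.
  case/existsP => h /forallP fg; apply/existsP; exists (h^-1)%g.
  by apply/forallP => x; rewrite (eqP (fg x)) conjgK.
by move=> f g; apply/idP/idP; apply: imp.
Qed.

Lemma conj_epi_trans : transitive conj_epi.
Proof.
move=> g f l /existsP[a /forallP fg] /existsP[b /forallP gl].
apply/existsP; exists (b * a)%g; apply/forallP => x.
by rewrite (eqP (fg x)) (eqP (gl x)) conjgM.
Qed.

Canonical conj_epi_equiv :=
  EquivRel conj_epi conj_epi_refl conj_epi_sym conj_epi_trans.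

Definition hom := {eq_quot conj_epi}.
HB.instance Definition _ := EqQuotient.on hom.
HB.instance Definition _ :=
  Finite.copy hom (can_type (EquivQuot.ereprK : cancel (_ : hom -> epi) _)).

Lemma epiM (f : epi) (x y : G) : f (x * y)%g = (f x * f y)%g.
Proof.
have /andP[/forallP/(_ (x, y)) /=] := valP f.
by rewrite !inE /= => /eqP.
Qed.

Lemma epiJ (f : epi) (x y : G) : f (x ^ y)%g = (f x ^ f y)%g.
Proof.
apply: (mulgI (f y)); rewrite -epiM !conjgE !mulgA mulgV mul1g epiM.
by rewrite mulgV mul1g.
Qed.

Lemma epi_surj (f : epi) (y : H) : exists x, f x = y.
Proof.
have /andP[_ /eqP/setP/(_ y)] := valP f.
by rewrite inE => /imsetP[x _ ->]; exists x.
Qed.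

End OuterHom.

Lemma is_epi_id (G : finGroupType) : is_epi [ffun x : G => x].
Proof.
apply/andP; split; first by apply/forall_inP => -[x y] _; rewrite !ffunE.
apply/eqP/setP => x; rewrite !inE; apply/imsetP.
by exists x; rewrite ?ffunE ?inE.
Qed.

Definition epi_id (G : finGroupType) : epi G G := Epi (is_epi_id G).

Lemma is_epi_comp (G H K : finGroupType) (g : epi H K) (f : epi G H) :
  is_epi [ffun x : G => g (f x)].
Proof.
apply/andP; split.
  by apply/forall_inP => -[x y] _; rewrite !ffunE !epiM.
apply/eqP/setP => z; rewrite !inE; apply/imsetP.
have [y <-] := epi_surj g z; have [x <-] := epi_surj f y.
by exists x; rewrite ?ffunE ?inE.
Qed.

Definition epi_comp (G H K : finGroupType) (g : epi H K) (f : epi G H) :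
  epi G K := Epi (is_epi_comp g f).

Definition hom_id (G : finGroupType) : hom G G := \pi_(hom G G) (epi_id G).

Definition hom_comp (G H K : finGroupType) (g : hom H K) (f : hom G H) :
  hom G K := \pi_(hom G K) (epi_comp (repr g) (repr f)).

Lemma homP (G H : finGroupType) (f g : epi G H) :
  reflect (exists h : H, forall x, f x = (g x ^ h)%g)
          (\pi_(hom G H) f == \pi_(hom G H) g).
Proof.
rewrite eqmodE; apply: (iffP existsP) => -[h fg]; exists h.
  by move=> x; apply/eqP/(forallP fg).
by apply/forallP => x; apply/eqP.
Qed.

Lemma hom_comp_pi (G H K : finGroupType) (g : epi H K) (f : epi G H) :
  hom_comp (\pi_(hom H K) g) (\pi_(hom G H) f) = \pi_(hom G K) (epi_comp g f).
Proof.
have /homP[a ga] : \pi_(hom H K) (repr (\pi_(hom H K) g)) == \pi_(hom H K) g.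
  by rewrite reprK.
have /homP[b fb] : \pi_(hom G H) (repr (\pi_(hom G H) f)) == \pi_(hom G H) f.
  by rewrite reprK.
apply/eqP/homP; exists (g b * a)%g => x.
by rewrite /= !ffunE ga fb epiJ conjgM.
Qed.

Lemma hom_compA (G H K L : finGroupType)
    (h : hom K L) (g : hom H K) (f : hom G H) :
  hom_comp h (hom_comp g f) = hom_comp (hom_comp h g) f.
Proof.
elim/quotW: h => h; elim/quotW: g => g; elim/quotW: f => f.
rewrite (hom_comp_pi g f) (hom_comp_pi h g) !hom_comp_pi.
apply: (congr1 (\pi_(hom G L))).
by apply: val_inj; apply/ffunP => x; do !rewrite ffunE /=.
Qed.

Lemma hom_comp1 (G H : finGroupType) (f : hom G H) :
  hom_comp f (hom_id G) = f.
Proof.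
elim/quotW: f => f; rewrite hom_comp_pi; apply: (congr1 (\pi_(hom G H))).
by apply: val_inj; apply/ffunP => x; rewrite /= !ffunE.
Qed.

Lemma hom_1comp (G H : finGroupType) (f : hom G H) :
  hom_comp (hom_id H) f = f.
Proof.
elim/quotW: f => f; rewrite hom_comp_pi; apply: (congr1 (\pi_(hom G H))).
by apply: val_inj; apply/ffunP => x; rewrite /= !ffunE.
Qed.

Definition isomorphic (G H : finGroupType) : Prop :=
  exists (f : hom G H) (g : hom H G),
    hom_comp g f = hom_id G /\ hom_comp f g = hom_id H.

(* A class U of finite groups stands for the full subcategory it spans. *)
Definition replete (U : finGroupType -> Prop) : Prop :=
  forall G H : finGroupType, U G -> isomorphic G H -> U H.

Record ob (U : finGroupType -> Prop) := Ob {
  ob_group :> finGroupType;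
  ob_mem : U ob_group
}.

Record functor (k : fieldType) (U : finGroupType -> Prop) := Functor {
  fobj :> ob U -> lmodType k;
  fmap : forall T S : ob U, hom T S -> {linear fobj S -> fobj T};
  fmap_id : forall (T : ob U) (x : fobj T), fmap (hom_id T) x = x;
  fmap_comp : forall (T S Q : ob U) (g : hom S Q) (f : hom T S) (x : fobj Q),
    @fmap T Q (hom_comp g f) x = fmap f (fmap g x)
}.
Arguments fmap {k U} f {T S} _ : rename.

Record nat_trans (k : fieldType) (U : finGroupType -> Prop)
    (X Y : functor k U) := NatTrans {
  component :> forall T : ob U, {linear X T -> Y T};
  naturality : forall (T S : ob U) (f : hom T S) (x : X S),
    component T (fmap X f x) = fmap Y f (component S x)
}.

(* The free module k[S] on a finite set S is {ffun S -> k^o}; the map f^* is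
   the linear extension of a |-> a \o f. *)
Section Representable.
Variables (k : fieldType) (U : finGroupType -> Prop) (G : ob U).

Definition rep_obj (T : ob U) : lmodType k := {ffun hom T G -> k^o}.

Definition rep_map_fun (T S : ob U) (f : hom T S) (u : rep_obj S) : rep_obj T :=
  [ffun b => \sum_(a : hom S G | hom_comp a f == b) u a].

Lemma rep_map_is_linear (T S : ob U) (f : hom T S) : linear (rep_map_fun f).
Proof.
move=> c u v; apply/ffunP => b; rewrite !ffunE scaler_sumr -big_split /=.
by apply: eq_bigr => a _; rewrite !ffunE.
Qed.

HB.instance Definition _ (T S : ob U) (f : hom T S) :=
  GRing.isLinear.Build k (rep_obj S) (rep_obj T) _ (rep_map_fun f)
    (rep_map_is_linear f).

Definition rep_map (T S : ob U) (f : hom T S) :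
  {linear rep_obj S -> rep_obj T} := rep_map_fun f.

Lemma rep_map_id (T : ob U) (u : rep_obj T) : rep_map (hom_id T) u = u.
Proof.
apply/ffunP => b; rewrite ffunE (big_pred1 b) // => a.
by rewrite hom_comp1.
Qed.

Lemma rep_map_comp (T S Q : ob U) (g : hom S Q) (f : hom T S) (u : rep_obj Q) :
  rep_map (hom_comp g f) u = rep_map f (rep_map g u).
Proof.
apply/ffunP => b; rewrite !ffunE.
rewrite (partition_big (fun a => hom_comp a g) (fun c => hom_comp c f == b)) /=.
  apply: eq_bigr => c /eqP <-; rewrite ffunE; apply: eq_bigl => a.
  by rewrite hom_compA; case: (hom_comp a g =P c) => [->|_]; rewrite ?eqxx ?andbF.
by move=> a; rewrite hom_compA.
Qed.

Definition representable : functor k U := Functor rep_map_id rep_map_comp.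

End Representable.

Definition delta (T : finGroupType) : nat := 'm([set: T])%g.

Section Growth.
Variables (R : realType) (k : fieldType) (U : finGroupType -> Prop).

Definition lin_indep (V : lmodType k) (n : nat) (v : 'I_n -> V) : Prop :=
  forall c : 'I_n -> k, \sum_i c i *: v i = 0 -> forall i, c i = 0.

(* Equal to +oo exactly when V is infinite-dimensional. *)
Definition dimension (V : lmodType k) : \bar R :=
  ereal_sup [set (n%:R)%:E |
    n in [set n : nat | exists v : 'I_n -> V, lin_indep v]]%classic.

Definition rank_ge (m : nat) (T : ob U) : Prop := (m <= delta T)%N.

Definition expansive : Prop :=
  forall (G : ob U) (m : nat),
    exists2 T : ob U, rank_ge m T & inhabited (hom T G).

(* The sup is over a set of extended reals, not over an image of a [set (ob U)],
   because [ob U] lies in too large a universe for [set]. *)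
Definition omega (n : nat) (X : functor k U) : \bar R :=
  limn (fun m : nat =>
    ereal_sup [set a : \bar R | exists2 T : ob U, rank_ge m T &
      a = (dimension (X T) * ((n%:R ^+ delta T)^-1)%:E)%E]%classic).

Definition complete : Prop :=
  expansive /\
  forall (n : nat) (G : ob U), (0 < n)%N -> #|G| = n ->
    (0 < omega n (representable k G))%E /\
    (omega n (representable k G) < +oo)%E.

End Growth.

Section Homological.
Variables (k : fieldType) (U : finGroupType -> Prop).
Implicit Types X Y Z P : functor k U.

Definition epimorphism X Y (p : nat_trans X Y) : Prop :=
  forall (Z : functor k U) (g h : nat_trans Y Z),
    (forall (T : ob U) (x : X T), g T (p T x) = h T (p T x)) ->
    forall (T : ob U) (y : Y T), g T y = h T y.

Definition projective P : Prop :=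
  forall (X Y : functor k U) (p : nat_trans X Y) (f : nat_trans P Y),
    epimorphism p ->
    exists g : nat_trans P X, forall (T : ob U) (x : P T), p T (g T x) = f T x.

Definition is_zero X : Prop := forall (T : ob U) (x : X T), x = 0.

Definition is_direct_sum (I : finType) (P : I -> functor k U) X : Prop :=
  exists (inj : forall i, nat_trans (P i) X)
         (proj : forall i, nat_trans X (P i)),
    [/\ forall i (T : ob U) (x : P i T), proj i T (inj i T x) = x,
        forall i j (T : ob U) (x : P i T),
          i != j -> proj j T (inj i T x) = 0
      & forall (T : ob U) (x : X T), \sum_i inj i T (proj i T x) = x].

Definition indecomposable X : Prop :=
  ~ is_zero X /\
  forall P : bool -> functor k U,
    is_direct_sum P X -> is_zero (P true) \/ is_zero (P false).

Definition finitely_projective X : Prop :=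
  exists (n : nat) (P : 'I_n -> functor k U),
    (forall i, indecomposable (P i) /\ projective (P i)) /\ is_direct_sum P X.

(* Kernels and images in AU are computed objectwise. *)
Definition exact X Y Z (f : nat_trans X Y) (g : nat_trans Y Z) : Prop :=
  forall (T : ob U) (y : Y T), g T y = 0 <-> exists x : X T, f T x = y.

(* ... -> C 2 -> C 1 -> C 0 -> X -> 0, with C i = 0 for i >> 0. *)
Definition is_finite_resolution X (C : nat -> functor k U)
    (d : forall i, nat_trans (C i.+1) (C i)) (aug : nat_trans (C 0%N) X) : Prop :=
  [/\ epimorphism aug,
      exact (d 0%N) aug,
      forall i, exact (d i.+1) (d i)
    & exists N : nat, forall i, (N <= i)%N -> is_zero (C i)].

Definition has_finite_projective_resolution X : Prop :=
  exists (C : nat -> functor k U) (d : forall i, nat_trans (C i.+1) (C i))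
         (aug : nat_trans (C 0%N) X),
    is_finite_resolution d aug /\ forall i, projective (C i).

Definition perfect X : Prop :=
  exists (C : nat -> functor k U) (d : forall i, nat_trans (C i.+1) (C i))
         (aug : nat_trans (C 0%N) X),
    is_finite_resolution d aug /\ forall i, finitely_projective (C i).

End Homological.

(* Main.v *)
From HB Require Import structures.
From mathcomp Require Import all_boot all_order all_algebra all_fingroup.
From mathcomp Require Import generic_quotient ring_quotient.
From mathcomp Require Import boolp classical_sets reals ereal topology.
From mathcomp Require Import normedtype sequences.
Require Import Defs.
Set Implicit Arguments.
Unset Strict Implicit.
Unset Printing Implicit Defensive.
Import Order.TTheory GRing.Theory Num.Theory.
Import numFieldNormedType.Exports.
Local Open Scope ring_scope.

(** Why the theorem holds.  Morphisms being surjections, every morphism out of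
    G is an isomorphism or strictly lowers the order, so each X(G) contains
    the subspace of decomposable elements, spanned by the f^* y with y living
    on a strictly smaller group.  Decomposables form a subfunctor and the
    quotient top X = X / decomposables is acted on only by isomorphisms.

    The statement reduces to the splitting of monomorphisms u : P -> Q between
    projectives.  Given a resolution C, let K_i be the cokernel of
    C_(i+1) -> C_i; then K_(i+1) embeds in C_i with cokernel K_i, so if
    K_(i+1) is projective the embedding splits and K_i is a retract of C_i.
    The K_i vanish for large i, and K_0 is the resolved object
    (finite_resolution_projective).

    Growth makes u injective on tops (mono_reflects_decomposable).  Suppose
    that x in P(G) is not decomposable but u(x) is.  Since P is projective, a
    functional that detects x modulo decomposables lifts to a morphism
    P -> e_G not killing x, and outer automorphisms act freely on surjections,
    so the translates f^* x, f : T -> G, span at least |U(T,G)| / |Out G|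
    dimensions.  Their images lie in the span of the translates of finitely
    many elements defined on groups of order < |G|, which has dimension
    O((|G| - 1)^delta(T)).  Completeness says that |U(T,G)| is of order
    |G|^delta(T) for suitable T with delta(T) arbitrarily large: contradiction.

    A morphism that is injective on tops splits (split_mono).  On each group E
    choose a linear retraction of the map of tops; in characteristic zero it
    may be averaged over isomorphisms with a chosen representative of each
    isomorphism class, which makes it natural, and projectivity of Q lifts the
    result to s : Q -> P with s u a nonzero scalar modulo decomposables on each
    group.  By induction on the order, s u is surjective, and projectivity of P
    then makes it invertible (nakayama).

    For perfect objects, an indecomposable projective is a retract of a single
    e_G (indecomposable_projective_retract), so the resolved object X is a
    retract of a finite sum of functors e_(G_i).  The total dimension of the
    spaces X(G_i) is finite and drops strictly when a nonzero summand is split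
    off, so splitting X into indecomposables stops (rank_le_decompose). *)

(** * Linear algebra without finiteness *)

Section LinearAlgebra.
Variable k : fieldType.
Implicit Types V W : lmodType k.

Definition subspace V (D : V -> Prop) : Prop :=
  D 0 /\ forall (c : k) x y, D x -> D y -> D (c *: x + y).

Lemma subspaceD V (D : V -> Prop) x y :
  subspace D -> D x -> D y -> D (x + y).
Proof. by move=> [_ DD] Dx Dy; rewrite -[x]scale1r; apply: DD. Qed.

Lemma subspaceZ V (D : V -> Prop) c x : subspace D -> D x -> D (c *: x).
Proof. by move=> [D0 DD] Dx; rewrite -[_ *: _]addr0; apply: DD. Qed.

Lemma subspaceB V (D : V -> Prop) x y :
  subspace D -> D x -> D y -> D (x - y).
Proof. by move=> [_ DD] Dx Dy; rewrite addrC -scaleN1r; apply: DD. Qed.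

Lemma subspaceBC V (D : V -> Prop) x y :
  subspace D -> D (x - y) -> D (y - x).
Proof. by move=> sD Dxy; rewrite -opprB -scaleN1r; apply: subspaceZ. Qed.

Lemma subspace_trans V (D : V -> Prop) x y z :
  subspace D -> D (x - y) -> D (y - z) -> D (x - z).
Proof. by move=> sD Dxy Dyz; rewrite -(subrK y x) -addrA; apply: subspaceD. Qed.

Lemma subspace_sum V (D : V -> Prop) (I : Type) (r : seq I) (A : pred I)
    (F : I -> V) :
  subspace D -> (forall i, A i -> D (F i)) -> D (\sum_(i <- r | A i) F i).
Proof.
move=> sD DF; apply: (big_ind D) => //; first by case: sD.
by move=> x y; apply: subspaceD.
Qed.

(** Linear maps are often obtained from choice or from a quotient; this turns
    such a function and its linearity proof into a bundled linear map. *)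
Section LinearOf.
Variables (V W : lmodType k) (f : V -> W) (f_lin : linear f).
HB.instance Definition _ := GRing.isLinear.Build k V W _ f f_lin.
Definition linear_of : {linear V -> W} := f.
End LinearOf.

(** A linear relation S contains the graph of a linear map on its domain, and
    that map extends to all of W: by Zorn, take a maximal single-valued linear
    relation A agreeing with S on the domain of S.  This one statement yields
    linear functionals, sections and retractions without bases. *)
Lemma linear_uniformization W V (S : W -> V -> Prop) :
  S 0 0 ->
  (forall c w1 v1 w2 v2,
     S w1 v1 -> S w2 v2 -> S (c *: w1 + w2) (c *: v1 + v2)) ->
  exists rho : {linear W -> V}, forall w v, S w v -> S w (rho w).
Proof.
move=> S0 SD.
pose good (A : set (W * V)) :=
  [/\ A (0, 0),
      forall c w1 v1 w2 v2, A (w1, v1) -> A (w2, v2) ->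
        A (c *: w1 + w2, c *: v1 + v2),
      forall v, A (0, v) -> v = 0
    & forall w v v', A (w, v) -> S w v' -> S w v].
pose P (A : set (W * V)) := A = set0 \/ good A.
have [F FP Ftot|A [PA Amax]] := @Zorn_bigcup (W * V)%type P.
  have [[A FA A0]|F0] := pselect (exists2 A, F A & exists x, A x); last first.
    left; apply/seteqP; split=> // x [A FA Ax].
    by case: F0; exists A => //; exists x.
  have gF B x : F B -> B x -> good B.
    by move=> FB Bx; case: (FP _ FB) => // B0; rewrite B0 in Bx.
  right; split.
  - by case: A0 => x Ax; exists A => //; case: (gF _ _ FA Ax).
  - move=> c w1 v1 w2 v2 [B1 F1 H1] [B2 F2 H2].
    case: (Ftot _ _ F1 F2) => s12.
      exists B2 => //; case: (gF _ _ F2 H2) => _ + _ _.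
      by apply=> //; apply: s12.
    exists B1 => //; case: (gF _ _ F1 H1) => _ + _ _.
    by apply=> //; apply: s12.
  - by move=> v [B FB Bv]; case: (gF _ _ FB Bv) => _ _ + _; apply.
  - by move=> w v v' [B FB Bv]; case: (gF _ _ FB Bv) => _ _ _; apply.
have gA : good A.
  case: PA => // A0; exfalso.
  apply: (Amax [set (0, 0)]%classic).
    by rewrite A0; split=> // /(_ (0, 0) erefl).
  right; split=> //=.
  - by move=> c w1 v1 w2 v2 [-> ->] [-> ->]; rewrite !scaler0 !addr0.
  - by move=> v [].
  - by move=> w v v' [-> ->] _.
have [A0 AD Afun AS] := gA.
have Auniq w v v' : A (w, v) -> A (w, v') -> v = v'.
  move=> Av Av'; apply/subr0_eq/Afun.
  by have := AD (-1) _ _ _ _ Av' Av; rewrite !scaleN1r addNr addrC.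
have Atot w : exists v, A (w, v).
  apply: contrapT => Nw.
  (* A is extended by the line through (w, v0).  If some translate w + w2 with
     w2 in the domain of A lies in the domain of S, linearity forces v0;
     otherwise no nonzero multiple of w lies in the sum of the two domains, and
     any v0 will do. *)
  have [v0 v0P] : exists v0, forall c w1 v1 v', A (w1, v1) ->
      S (c *: w + w1) v' -> S (c *: w + w1) (c *: v0 + v1).
    have [[w2 [v2 [v3 [A2 S3]]]]|N2] :=
      pselect (exists w2 v2 v3, A (w2, v2) /\ S (w + w2) v3).
      exists (v3 - v2) => c w1 v1 v' A1 S1.
      have A3 : A (w1 - c *: w2, v1 - c *: v2).
        by have := AD (- c) _ _ _ _ A2 A1; rewrite !scaleNr ![- _ + _]addrC.
      have S4 : S (w1 - c *: w2) (v1 - c *: v2).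
        apply: (AS _ _ (- c *: v3 + v') A3).
        have -> : w1 - c *: w2 = - c *: (w + w2) + (c *: w + w1).
          by rewrite scaleNr scalerDr opprD addrACA addNr add0r addrC.
        exact: SD.
      have := SD c _ _ _ _ S3 S4.
      by rewrite scalerDr scalerBr -!addrA !(addrCA (c *: w2)) addrN addr0
                 (addrC v1).
    exists 0 => c w1 v1 v' A1 S1; rewrite scaler0 add0r.
    have [c0|c0] := eqVneq c 0.
      by move: S1; rewrite c0 scale0r add0r; apply: AS.
    case: N2; exists (c^-1 *: w1), (c^-1 *: v1), (c^-1 *: v'); split.
      by have := AD c^-1 _ _ _ _ A1 A0; rewrite !addr0.
    by have := SD c^-1 _ _ _ _ S1 S0; rewrite !addr0 scalerDr scalerA mulVf
              ?scale1r.
  pose B : set (W * V) := [set p | exists c w1 v1, [/\ A (w1, v1),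
     p.1 = c *: w + w1 & p.2 = c *: v0 + v1]]%classic.
  apply: (Amax B).
    split=> [[w1 v1] A1|].
      by exists 0, w1, v1; rewrite !scale0r !add0r.
    move=> /(_ (w, v0)) BA; apply: Nw; exists v0; apply: BA.
    by exists 1, 0, 0; rewrite !scale1r !addr0.
  right; split.
  - by exists 0, 0, 0; rewrite !scale0r !addr0.
  - move=> c _ _ _ _ [c1 [w1 [v1 [A1 /= -> ->]]]] [c2 [w2 [v2 [A2 /= -> ->]]]].
    exists (c * c1 + c2), (c *: w1 + w2), (c *: v1 + v2).
    split; [exact: AD | |] => /=;
    by rewrite scalerDr scalerDl scalerA addrACA.
  - move=> _ [c [w1 [v1 [A1 /= + ->]]]].
    have [->|c0] := eqVneq c 0.
      by rewrite !scale0r !add0r => w10; apply: Afun; rewrite w10.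
    move=> /esym/eqP; rewrite addr_eq0 => /eqP cw; case: Nw.
    exists (- c^-1 *: v1).
    have := AD (- c^-1) _ _ _ _ A1 A0; rewrite !addr0.
    by rewrite -[w1]opprK -cw scaleNr scalerN opprK scalerA mulVf ?scale1r.
  - by move=> _ _ v' [c [w1 [v1 [A1 /= -> ->]]]]; apply: v0P.
have [r rA] := choice Atot.
have r_lin : linear r.
  move=> c x y; apply: Auniq (rA _) _.
  by apply: AD; apply: rA.
exists (linear_of r_lin) => w v Swv.
exact: AS (rA w) Swv.
Qed.

(** With more vectors than generators, the matrix of coordinates has a nonzero
    row kernel, which is a dependency. *)
Lemma lin_indep_le_span V (I : finType) (n : nat) (v : 'I_n -> V)
    (w : I -> V) :
  lin_indep v -> (forall l, exists c : I -> k, v l = \sum_i c i *: w i) ->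
  (n <= #|I|)%N.
Proof.
move=> indv /choice[c vE].
rewrite leqNgt; apply/negP => ltn.
pose A : 'M[k]_(n, #|I|) := \matrix_(l, i) c l (enum_val i).
have /rowV0Pn[u /sub_kermxP uA u0] : kermx A != 0.
  rewrite -mxrank_eq0 mxrank_ker subn_eq0 -ltnNge.
  exact: leq_ltn_trans (rank_leq_col _) ltn.
suff z : forall l, u 0 l = 0.
  by move/eqP: u0; apply; apply/rowP => l; rewrite mxE z.
apply: indv.
under eq_bigr do rewrite vE scaler_sumr.
rewrite exchange_big big1 //= => i _.
under eq_bigr do rewrite scalerA.
rewrite -scaler_suml (_ : \sum_i0 _ = 0) ?scale0r //.
have := congr1 (fun M : 'rV_#|I| => M 0 (enum_rank i)) uA; rewrite !mxE.
apply: etrans.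
by apply: eq_bigr => l _; rewrite mxE enum_rankK.
Qed.

Section QuotientSpace.
Variables (V : lmodType k) (D : V -> Prop) (sD : subspace D).

(** The proof that D is a subspace is a parameter so that the closure instance
    below can be inferred from the predicate alone. *)
Definition subspace_pred (sD : subspace D) : V -> bool := fun x => `[< D x >].

Lemma subspace_pred_zmod : zmod_closed (subspace_pred sD).
Proof.
split; first by apply/asboolP; case: sD.
move=> x y /asboolP Dx /asboolP Dy; apply/asboolP.
exact: subspaceB.
Qed.
HB.instance Definition _ :=
  GRing.isZmodClosed.Build V (subspace_pred sD) subspace_pred_zmod.

Definition quot_space :=
  Quotient.quot (GRing.ZmodClosed.clone V (subspace_pred sD) _).
HB.instance Definition _ := GRing.Zmodule.on quot_space.

Definition quot_pi (x : V) : quot_space := \pi_quot_space%qT x.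

Lemma quot_piP x y : quot_pi x = quot_pi y <-> D (x - y).
Proof.
split=> [/eqP|Dxy]; first by rewrite -Quotient.idealrBE => /asboolP.
by apply/eqP; rewrite -Quotient.idealrBE; apply/asboolP.
Qed.

Lemma quot_pi_surj z : exists x, quot_pi x = z.
Proof. by exists (repr z); apply: reprK. Qed.

Lemma quot_reprP x : D (repr (quot_pi x) - x).
Proof. by apply/quot_piP; rewrite /quot_pi reprK. Qed.

Lemma quot_piD x y : quot_pi (x + y) = quot_pi x + quot_pi y.
Proof. by rewrite /quot_pi !piE. Qed.

Definition quot_scale (c : k) (z : quot_space) : quot_space :=
  quot_pi (c *: repr z).

Lemma quot_scaleE c x : quot_scale c (quot_pi x) = quot_pi (c *: x).
Proof.
by apply/quot_piP; rewrite -scalerBr; apply: subspaceZ => //; apply: quot_reprP.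
Qed.

Lemma quot_scaleA a b z : quot_scale a (quot_scale b z) = quot_scale (a * b) z.
Proof. by have [x <-] := quot_pi_surj z; rewrite !quot_scaleE scalerA. Qed.

Lemma quot_scale1 : left_id 1 quot_scale.
Proof.
by move=> z; have [x <-] := quot_pi_surj z; rewrite quot_scaleE scale1r.
Qed.

Lemma quot_scaleDr : right_distributive quot_scale +%R.
Proof.
move=> c z t; have [x <-] := quot_pi_surj z; have [y <-] := quot_pi_surj t.
by rewrite -quot_piD !quot_scaleE scalerDr quot_piD.
Qed.

Lemma quot_scaleDl z : {morph quot_scale^~ z : a b / a + b}.
Proof.
move=> a b; have [x <-] := quot_pi_surj z.
by rewrite !quot_scaleE scalerDl quot_piD.
Qed.

HB.instance Definition _ := GRing.Zmodule_isLmodule.Build k quot_space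
  quot_scaleA quot_scale1 quot_scaleDr quot_scaleDl.

Lemma quot_pi_linear : linear quot_pi.
Proof. by move=> c x y; rewrite quot_piD -quot_scaleE. Qed.

End QuotientSpace.

End LinearAlgebra.

(** * Outer surjections *)

Section OuterSurjections.
Implicit Types T S E : finGroupType.
Local Open Scope quotient_scope.

Lemma hom_card_le T S (f : hom T S) : (#|S| <= #|T|)%N.
Proof.
elim/quotW: f => f; have /andP[_ /eqP fS] := valP f.
by rewrite -cardsT -fS (leq_trans (leq_imset_card _ _)) ?cardsT.
Qed.

Lemma hom_inverse T S (f : hom T S) : #|T| = #|S| ->
  exists g : hom S T, hom_comp g f = hom_id T /\ hom_comp f g = hom_id S.
Proof.
elim/quotW: f => f cTS; have /andP[_ /eqP fS] := valP f.
have f_inj : injective f.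
  have /imset_injP H : #|f @: [set: T]| == #|[set: T]|.
    by rewrite [f @: _]fS !cardsT cTS.
  by move=> x y; apply: H; rewrite inE.
have [g fK gK] : bijective f by apply: inj_card_bij; rewrite ?cTS.
have g_epi : is_epi [ffun y => g y].
  apply/andP; split.
    apply/forall_inP => -[x y] _; rewrite !ffunE; apply/eqP/f_inj.
    by rewrite epiM !gK.
  apply/eqP/setP => x; rewrite !inE; apply/imsetP.
  by exists (f x); rewrite ?ffunE ?inE ?fK.
exists (\pi_(hom S T) (Epi g_epi)); rewrite !hom_comp_pi.
by split; apply: congr1; apply: val_inj; apply/ffunP => x;
  rewrite /= !ffunE /= ?ffunE ?fK ?gK.
Qed.

(** Surjections are epimorphisms of groups; this gives the freeness of the
    action of outer automorphisms on surjections. *)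
Lemma hom_comp_injl T S E (f : hom T S) :
  injective (fun a : hom S E => hom_comp a f).
Proof.
move=> a b; elim/quotW: f => f; elim/quotW: a => a; elim/quotW: b => b /=.
rewrite !hom_comp_pi => /eqP/homP[h ab]; apply/eqP/homP; exists h => y.
by have [x <-] := epi_surj f y; have := ab x; rewrite /= !ffunE.
Qed.

Lemma isomorphic_refl T : isomorphic T T.
Proof. by exists (hom_id T), (hom_id T); rewrite hom_comp1. Qed.

(** Equality of predicates, rather than equivalence, lets a choice made from
    the isomorphism class of T coincide with the one made from that of S. *)
Lemma isomorphic_eq T S (f : hom T S) : #|T| = #|S| ->
  isomorphic T = isomorphic S.
Proof.
move=> /(hom_inverse f)[f' [f'f ff']]; apply/funext => E; apply/propext; split.
  move=> [g [g' [g'g gg']]]; exists (hom_comp g f'), (hom_comp f g').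
  rewrite -!hom_compA (hom_compA g') g'g hom_1comp ff'; split=> //.
  by rewrite (hom_compA f') f'f hom_1comp gg'.
move=> [g [g' [g'g gg']]]; exists (hom_comp g f), (hom_comp f' g').
rewrite -!hom_compA (hom_compA g') g'g hom_1comp f'f; split=> //.
by rewrite (hom_compA f) ff' hom_1comp gg'.
Qed.

End OuterSurjections.

(** * The functor category *)

Section Functors.
Variables (k : fieldType) (U : finGroupType -> Prop).
Implicit Types (X Y Z : functor k U) (T S E G : ob U).

Section NatOf.
Variables (X Y : functor k U) (c : forall T, X T -> Y T).
Hypothesis c_lin : forall T, linear (@c T).
Hypothesis c_nat :
  forall T S (f : hom T S) x, c (fmap X f x) = fmap Y f (@c S x).
Definition nat_of : nat_trans X Y :=
  @NatTrans k U X Y (fun T => linear_of (@c_lin T)) c_nat.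
End NatOf.

Definition nat_id X : nat_trans X X :=
  @nat_of X X (fun T x => x) (fun T c x y => erefl) (fun T S f x => erefl).

Lemma nat_comp_nat X Y Z (q : nat_trans Y Z) (p : nat_trans X Y) T S
    (f : hom T S) x : q T (p T (fmap X f x)) = fmap Z f (q S (p S x)).
Proof. by rewrite !naturality. Qed.

Lemma nat_comp_lin X Y Z (q : nat_trans Y Z) (p : nat_trans X Y) T :
  linear (fun x => q T (p T x)).
Proof. by move=> c x y; rewrite !linearP. Qed.

Definition nat_comp X Y Z (q : nat_trans Y Z) (p : nat_trans X Y) :
    nat_trans X Z :=
  nat_of (nat_comp_lin q p) (nat_comp_nat q p).

Lemma nat_sum_nat X Y (I : finType) (p : I -> nat_trans X Y) T S
    (f : hom T S) x : \sum_i p i T (fmap X f x) = fmap Y f (\sum_i p i S x).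
Proof. by rewrite linear_sum; apply: eq_bigr => i _; rewrite naturality. Qed.

Lemma nat_sum_lin X Y (I : finType) (p : I -> nat_trans X Y) T :
  linear (fun x => \sum_i p i T x).
Proof.
move=> c x y; rewrite scaler_sumr -big_split.
by apply: eq_bigr => i _; rewrite linearP.
Qed.

Definition nat_sum X Y (I : finType) (p : I -> nat_trans X Y) :
    nat_trans X Y := nat_of (nat_sum_lin p) (nat_sum_nat p).

Lemma nat_scale_lin X Y (c : k) (p : nat_trans X Y) T :
  linear (fun x => c *: p T x).
Proof. by move=> a x y; rewrite linearP scalerDr !scalerA mulrC. Qed.
Lemma nat_scale_nat X Y (c : k) (p : nat_trans X Y) T S (f : hom T S) x :
  c *: p T (fmap X f x) = fmap Y f (c *: p S x).
Proof. by rewrite naturality linearZ. Qed.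
Definition nat_scale X Y (c : k) (p : nat_trans X Y) : nat_trans X Y :=
  nat_of (nat_scale_lin c p) (nat_scale_nat c p).

Lemma nat_sub_lin X Y (p q : nat_trans X Y) T :
  linear (fun x => p T x - q T x).
Proof.
move=> a x y.
by rewrite (linearP (p T)) (linearP (q T)) scalerBr opprD addrACA.
Qed.

Lemma nat_sub_nat X Y (p q : nat_trans X Y) T S (f : hom T S) x :
  p T (fmap X f x) - q T (fmap X f x) = fmap Y f (p S x - q S x).
Proof. by rewrite !naturality linearB. Qed.
Definition nat_sub X Y (p q : nat_trans X Y) : nat_trans X Y :=
  nat_of (nat_sub_lin p q) (nat_sub_nat p q).

Definition subfunctor X (D : forall T, X T -> Prop) : Prop :=
  (forall T, subspace (D T)) /\
  forall T S (f : hom T S) x, D S x -> D T (fmap X f x).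

Section QuotientFunctor.
Variables (X : functor k U) (D : forall T, X T -> Prop) (sD : subfunctor D).
Let Q T : lmodType k := quot_space (sD.1 T).
Let q T (x : X T) : Q T := quot_pi (sD.1 T) x.

Definition quot_map_fun T S (f : hom T S) (z : Q S) : Q T :=
  q (fmap X f (repr z)).

Lemma quot_map_pi T S (f : hom T S) x : quot_map_fun f (q x) = q (fmap X f x).
Proof.
by apply/quot_piP; rewrite -linearB; apply: sD.2; apply: quot_reprP.
Qed.

Lemma quot_map_linear T S (f : hom T S) : linear (quot_map_fun f).
Proof.
move=> c z t; have [x <-] := quot_pi_surj z; have [y <-] := quot_pi_surj t.
by rewrite -quot_pi_linear !quot_map_pi linearP; apply: quot_pi_linear.
Qed.

Lemma quot_map_id T (z : Q T) : linear_of (quot_map_linear (hom_id T)) z = z.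
Proof.
have [x <-] := quot_pi_surj z.
by rewrite [LHS]quot_map_pi fmap_id.
Qed.

Lemma quot_map_comp T S E (g : hom S E) (f : hom T S) (z : Q E) :
  linear_of (quot_map_linear (hom_comp g f)) z =
  linear_of (quot_map_linear f) (linear_of (quot_map_linear g) z).
Proof.
have [x <-] := quot_pi_surj z.
have E1 : linear_of (quot_map_linear g) (q x) = q (fmap X g x).
  exact: quot_map_pi.
rewrite [LHS]quot_map_pi fmap_comp [in RHS]E1.
by symmetry; apply: quot_map_pi.
Qed.

Definition quot_functor : functor k U := Functor quot_map_id quot_map_comp.

Lemma quot_nat_nat T S (f : hom T S) x :
  q (fmap X f x) = fmap quot_functor f (q x).
Proof. by symmetry; apply: quot_map_pi. Qed.

Definition quot_nat : nat_trans X quot_functor :=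
  @nat_of X quot_functor q (fun T => @quot_pi_linear _ _ _ (sD.1 T))
    quot_nat_nat.

Lemma quot_natP T x y : quot_nat T x = quot_nat T y <-> D (x - y).
Proof. exact: quot_piP. Qed.

Lemma quot_nat0 T x : quot_nat T x = 0 <-> D x.
Proof. by rewrite -[in X in _ <-> X](subr0 x) -quot_natP linear0. Qed.

Lemma quot_nat_surj T (z : quot_functor T) : exists x, quot_nat T x = z.
Proof. exact: quot_pi_surj. Qed.

End QuotientFunctor.

Definition surjective_nat X Y (p : nat_trans X Y) : Prop :=
  forall T (y : Y T), exists x, p T x = y.

Lemma image_subfunctor X Y (p : nat_trans X Y) :
  subfunctor (fun T y => exists x, p T x = y).
Proof.
split=> [T|T S f _ [x <-]]; last by exists (fmap X f x); rewrite naturality.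
split; first by exists 0; rewrite linear0.
by move=> c _ _ [x <-] [y <-]; exists (c *: x + y); rewrite linearP.
Qed.

(** An epimorphism p equalizes the projection Y -> Y / im p and zero, so the
    image is everything. *)
Lemma epimorphismP X Y (p : nat_trans X Y) :
  epimorphism p <-> surjective_nat p.
Proof.
split=> [epi T y|sp Z g h gh T y]; last by have [x <-] := sp T y.
apply/(quot_nat0 (image_subfunctor p)).
rewrite -[RHS](subrr (quot_nat (image_subfunctor p) T y)).
apply: (epi _ _ (nat_sub _ _)) => S x /=.
by rewrite [RHS]subrr; apply/quot_nat0; exists x.
Qed.

(** Any choice of preimages works: two preimages differ by an element of the
    kernel, so linearity and naturality of n pass to the factorization. *)
Lemma factor_through_surj X Y Z (p : nat_trans X Y) (n : nat_trans X Z) :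
  surjective_nat p -> (forall T x, p T x = 0 -> n T x = 0) ->
  exists m : nat_trans Y Z, forall T x, m T (p T x) = n T x.
Proof.
move=> sp kp; pose r T y := projT1 (cid (sp T y)).
have rK T y : p T (r T y) = y by rewrite /r; case: cid.
pose c T y := n T (r T y).
have cE T x : c T (p T x) = n T x.
  by apply/subr0_eq; rewrite /c -linearB; apply: kp; rewrite linearB rK subrr.
have c_lin T : linear (c T).
  move=> a y z; rewrite -[y in LHS]rK -[z in LHS]rK.
  by rewrite -linearP cE linearP.
have c_nat T S (f : hom T S) y : c T (fmap Y f y) = fmap Z f (c S y).
  by rewrite -[y in LHS]rK -naturality cE naturality.
by exists (nat_of c_lin c_nat).
Qed.

Lemma projective_retract X Y (i : nat_trans Y X) (p : nat_trans X Y) :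
  (forall T y, p T (i T y) = y) -> projective X -> projective Y.
Proof.
move=> pi projX A B q f /(projX _ _ q (nat_comp f p))[g gq].
exists (nat_comp g i) => T y.
by rewrite [LHS]gq /= pi.
Qed.

Lemma projective_lift X Y Z (p : nat_trans Y Z) (f : nat_trans X Z) :
  projective X -> surjective_nat p ->
  exists g : nat_trans X Y, forall T x, p T (g T x) = f T x.
Proof. by move=> pX /epimorphismP; apply: pX. Qed.

Section Yoneda.
Variables (G : ob U).
Notation e := (representable k G).

Definition rep_basis T (f : hom T G) : e T := [ffun g => (g == f)%:R].

Lemma rep_sum T (u : e T) : u = \sum_(f : hom T G) u f *: rep_basis f.
Proof.
apply/ffunP => g; rewrite sum_ffunE (bigD1 g) //= !ffunE eqxx.
rewrite [_ *: _]mulr1 big1 ?addr0 // => f nf.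
by rewrite !ffunE eq_sym (negPf nf) scaler0.
Qed.

Lemma rep_basis_fmap T S (h : hom T S) (f : hom S G) :
  fmap e h (rep_basis f) = rep_basis (hom_comp f h).
Proof.
apply/ffunP => g; rewrite !ffunE.
transitivity (\sum_(a : hom S G | hom_comp a h == g) (a == f)%:R : k).
  by apply: eq_bigr => a _; rewrite ffunE.
rewrite big_mkcond (bigD1 f) //= eqxx big1 ?addr0.
  by rewrite eq_sym; case: eqP.
by move=> a /negPf ->; case: ifP.
Qed.

Definition yoneda_fun X (x : X G) T (u : e T) : X T :=
  \sum_(f : hom T G) u f *: fmap X f x.

Lemma yoneda_lin X (x : X G) T : linear (@yoneda_fun X x T).
Proof.
move=> c u v; rewrite /yoneda_fun scaler_sumr -big_split.
by apply: eq_bigr => f _; rewrite !ffunE scalerDl scalerA.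
Qed.

Lemma yoneda_basis X (x : X G) T (f : hom T G) :
  yoneda_fun x (rep_basis f) = fmap X f x.
Proof.
rewrite /yoneda_fun (bigD1 f) //= big1 ?addr0 ?ffunE ?eqxx ?scale1r //.
by move=> g /negPf ng; rewrite ffunE ng scale0r.
Qed.

Lemma yoneda_nat X (x : X G) T S (h : hom T S) u :
  yoneda_fun x (fmap e h u) = fmap X h (yoneda_fun x u).
Proof.
rewrite {1}[u]rep_sum linear_sum.
rewrite -[yoneda_fun x _]/(linear_of (@yoneda_lin X x T) _).
rewrite [LHS]linear_sum [in RHS]/yoneda_fun linear_sum; apply: eq_bigr => f _.
rewrite !linearZ /=; congr (_ *: _).
by rewrite rep_basis_fmap [LHS]yoneda_basis fmap_comp.
Qed.

Definition yoneda X (x : X G) : nat_trans e X :=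
  nat_of (yoneda_lin x) (yoneda_nat x).

Lemma yonedaE X (x : X G) T (f : hom T G) :
  yoneda x T (rep_basis f) = fmap X f x.
Proof. exact: yoneda_basis. Qed.

Lemma nat_rep_basis X (n : nat_trans e X) T (f : hom T G) :
  n T (rep_basis f) = fmap X f (n G (rep_basis (hom_id G))).
Proof. by rewrite -naturality rep_basis_fmap hom_1comp. Qed.

Lemma nat_rep_ext X (n m : nat_trans e X) :
  n G (rep_basis (hom_id G)) = m G (rep_basis (hom_id G)) ->
  forall T u, n T u = m T u.
Proof.
move=> nm T u; rewrite [u]rep_sum !linear_sum; apply: eq_bigr => f _.
by rewrite [n T _]linearZ [m T _]linearZ (nat_rep_basis n) (nat_rep_basis m) nm.
Qed.

End Yoneda.

End Functors.

(** * Decomposable elements, averaging and splitting *)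

Section Decomposables.
Variables (k : fieldType) (U : finGroupType -> Prop).
Implicit Types (X Y Z P Q : functor k U) (T S E G : ob U).

(** The radical of X, presented by its generators. *)
Inductive decomposable X T : X T -> Prop :=
| Decomposable0 : decomposable 0
| DecomposableD (x : X T) S (f : hom T S) (y : X S) :
    (#|S| < #|T|)%N -> decomposable x -> decomposable (x + fmap X f y).

Lemma decomposable_fmap_lt X T S (f : hom T S) (y : X S) :
  (#|S| < #|T|)%N -> decomposable (fmap X f y).
Proof. by move=> lt; rewrite -[fmap X f y]add0r; do !constructor. Qed.

Lemma decomposable_subfunctor X : subfunctor (@decomposable X).
Proof.
split=> [T|T S f x Dx].
  split=> [|c x y Dx Dy]; first by constructor.
  elim: Dx => [|x1 S f z lt Dx IH]; first by rewrite scaler0 add0r.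
  by rewrite scalerDr addrAC -linearZ; constructor.
elim: Dx => [|y S' g z lt Dy IH]; first by rewrite linear0; constructor.
rewrite linearD -fmap_comp; constructor => //.
exact: leq_trans lt (hom_card_le f).
Qed.

Lemma decomposable_subspace X T : subspace (@decomposable X T).
Proof. exact: (decomposable_subfunctor X).1. Qed.
Hint Resolve decomposable_subspace : core.

(** A family that is natural only modulo decomposables is an honest morphism to
    Y / decomposables, hence lifts. *)
Lemma lift_mod_decomposable X Y (c : forall T, X T -> Y T) :
  projective X -> (forall T, linear (c T)) ->
  (forall T S (h : hom T S) y,
     decomposable (c T (fmap X h y) - fmap Y h (c S y))) ->
  exists s : nat_trans X Y, forall T x, decomposable (s T x - c T x).
Proof.
move=> pX c_lin c_nat; pose q := quot_nat (decomposable_subfunctor Y).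
have qc_lin T : linear (fun x => q T (c T x)).
  by move=> a x y; rewrite c_lin linearP.
have qc_nat T S (h : hom T S) x : q T (c T (fmap X h x)) =
    fmap (quot_functor (decomposable_subfunctor Y)) h (q S (c S x)).
  by rewrite -naturality; apply/quot_natP.
have [s sE] := projective_lift (p := q) (nat_of qc_lin qc_nat) pX
  (@quot_nat_surj _ _ _ _ _).
exists s => T x; apply/(quot_natP (decomposable_subfunctor Y)).
by rewrite [LHS]sE.
Qed.

Section Average.
Variables (X Y : functor k U) (E : ob U) (rho : {linear X E -> Y E}).

(** Since inverses are not named in U, an isomorphism f is encoded as a pair
    with its inverse; this is the sum of f^* rho (f^-1)^* over isomorphisms
    f : T -> E, and there are none unless T and E are isomorphic. *)
Definition average T (x : X T) : Y T :=
  \sum_(p : hom T E * hom E T | hom_comp p.2 p.1 == hom_id T)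
    fmap Y p.1 (rho (fmap X p.2 x)).

Lemma average_linear T : linear (@average T).
Proof.
move=> c x y; rewrite /average scaler_sumr -big_split /=.
by apply: eq_bigr => p _; rewrite !linearP.
Qed.

(** Along an isomorphism the sum is reindexed.  Along a map h : T -> S that
    lowers the order, h^* produces decomposables, which rho preserves. *)
Lemma average_nat :
  (forall x, decomposable x -> decomposable (rho x)) ->
  forall T S (h : hom T S) (y : X S),
    decomposable (average (fmap X h y) - fmap Y h (average y)).
Proof.
move=> rhoD T S h y.
have := hom_card_le h; rewrite leq_eqVlt => /predU1P[ST|lt]; last first.
  apply: subspaceB => //; last exact: decomposable_fmap_lt.
  apply: subspace_sum => // p _; apply: (decomposable_subfunctor Y).2.
  apply: rhoD; rewrite -fmap_comp; apply: decomposable_fmap_lt.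
  exact: leq_trans lt (hom_card_le p.2).
have [h' [h'h hh']] := hom_inverse h (esym ST).
rewrite (_ : average _ = fmap Y h (average y)) ?subrr; last first.
  rewrite /average linear_sum (reindex (fun p : hom S E * hom E S =>
    (hom_comp p.1 h, hom_comp h' p.2))) /=; last first.
    exists (fun p => (hom_comp p.1 h', hom_comp h p.2)) => -[f g] _ /=;
    by rewrite -!hom_compA ?hh' ?h'h !hom_compA ?hh' ?h'h
               !(hom_comp1, hom_1comp).
  apply: eq_big => [[f g]|[f g] _] /=; last first.
    by rewrite -fmap_comp hom_compA hh' hom_1comp fmap_comp.
  apply/eqP/eqP => [gf|gf]; last first.
    by rewrite -hom_compA (hom_compA g) gf hom_1comp.
  rewrite -[LHS]hom_1comp -[LHS]hom_comp1 -{1}hh' -hh'.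
  transitivity
    (hom_comp h (hom_comp (hom_comp (hom_comp h' g) (hom_comp f h)) h')).
    by rewrite -!hom_compA.
  by rewrite gf hom_1comp.
by constructor.
Qed.

End Average.

(** Decomposables come from smaller groups, where w is surjective by induction
    on the order, so they are in the image; modulo them, w is an invertible
    scalar. *)
Lemma nakayama P (w : nat_trans P P) (c : ob U -> k) :
  (forall T, c T != 0) ->
  (forall T x, decomposable (w T x - c T *: x)) -> surjective_nat w.
Proof.
move=> c0 wc T; have [n] := ubnP #|T|; elim: n T => // n IH T leTn y.
have decI z : decomposable z -> exists x, w T x = z.
  elim=> [|z1 S f z2 lt _ [x <-]]; first by exists 0; rewrite linear0.
  have [x2 <-] := IH S (leq_trans lt leTn) z2.
  by exists (x + fmap P f x2); rewrite linearD naturality.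
have [x wx] := decI _ (wc T ((c T)^-1 *: y)).
exists ((c T)^-1 *: y - x).
by rewrite linearB wx scalerA mulfV // scale1r subKr.
Qed.

Lemma card_ob_pair_gt0 T E : isomorphic T E ->
  (0 < #|[pred p : hom T E * hom E T | hom_comp p.2 p.1 == hom_id T]|)%N.
Proof. by move=> [f [g [gf _]]]; apply/card_gt0P; exists (f, g); apply/eqP. Qed.

(** A pointwise retraction rho of u modulo decomposables exists because u
    reflects decomposability.  Averaging rho over the isomorphisms from T to a
    representative of its class gives s with s u congruent to N T, the number of
    these isomorphisms, which is nonzero in k.  If v is a section of the
    surjection s u, then v is also surjective, hence inverse to s u. *)
Lemma split_mono P Q (u : nat_trans P Q) :
  [pchar k] =i pred0 -> projective P -> projective Q ->
  (forall T x, decomposable (u T x) -> decomposable x) ->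
  exists r : nat_trans Q P, forall T x, r T (u T x) = x.
Proof.
move=> char0 pP pQ udec.
have rho_ex E : exists rho : {linear Q E -> P E},
    (forall x, decomposable x -> decomposable (rho x)) /\
    (forall x, decomposable (rho (u E x) - x)).
  pose S (w : Q E) (v : P E) := exists x,
    decomposable (w - u E x) /\ decomposable (v - x).
  have [|c w1 v1 w2 v2 [x1 [D1 D1']] [x2 [D2 D2']]|rho rhoS] :=
    @linear_uniformization k (Q E) (P E) S.
  - by exists 0; rewrite linear0 !subrr; split; constructor.
  - exists (c *: x1 + x2).
    rewrite linearP; split; rewrite opprD addrACA -scalerBr;
    by apply: (@decomposable_subspace _ _).2.
  exists rho; split=> x.
    move=> Dx; have [|z [Dz D']] := rhoS x 0.
      by exists 0; rewrite linear0 !subr0; split=> //; constructor.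
    rewrite -(subrK z (rho x)); apply: subspaceD => //; apply: udec.
    by rewrite -(subKr x (u E z)); apply: subspaceB.
  have [|z [Dz D']] := rhoS (u E x) x.
    by exists x; rewrite !subrr; split; constructor.
  apply: subspace_trans D' _ => //; apply: subspaceBC => //; apply: udec.
  by rewrite linearB.
pose rho E := projT1 (cid (rho_ex E)).
have rhoD E x : decomposable x -> decomposable (rho E x).
  by rewrite /rho; case: cid => r /= [+ _]; apply.
have rhou E x : decomposable (rho E (u E x) - x).
  by rewrite /rho; case: cid => r /= [_]; apply.
have rep_ex T : exists E : ob U, isomorphic T E.
  by exists T; apply: isomorphic_refl.
(* The representative depends on T only through its isomorphism class, so the
   retractions used on isomorphic groups are literally the same. *)
pose rep T := projT1 (cid (rep_ex T)).
have repP T : isomorphic T (rep T) by rewrite /rep; case: cid.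
have rep_eq T S (h : hom T S) : #|T| = #|S| -> rep T = rep S.
  move=> cTS; rewrite /rep; move: (rep_ex T) (rep_ex S).
  rewrite (isomorphic_eq h cTS) => p q.
  by rewrite (Prop_irrelevance p q).
have [|T S h y|s sE] := lift_mod_decomposable
    (c := fun T => average (rho (rep T)) (T := T)) pQ.
- by move=> T; apply: average_linear.
- have := hom_card_le h; rewrite leq_eqVlt => /predU1P[ST|lt].
    by rewrite (rep_eq _ _ h) //; apply: average_nat => x; apply: rhoD.
  apply: subspaceB => //; last exact: decomposable_fmap_lt.
  have /(_ (rhoD (rep T)) _ _ h y) Dav := @average_nat _ _ _ (rho (rep T)).
  rewrite -[average _ _](subrK (fmap P h (average (rho (rep T)) y))).
  by apply: subspaceD => //; apply: decomposable_fmap_lt.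
pose N T : k := #|[pred p : hom T (rep T) * hom (rep T) T |
                  hom_comp p.2 p.1 == hom_id T]|%:R.
have N0 T : N T != 0.
  by rewrite ((pcharf0P k).1 char0) -lt0n card_ob_pair_gt0.
pose w := nat_comp s u.
have wN T x : decomposable (w T x - N T *: x).
  apply: subspace_trans (sE T (u T x)) _ => //.
  rewrite scaler_nat -sumr_const /average -sumrB.
  apply: subspace_sum => // -[f g] /eqP /= gf.
  have xE : fmap P f (fmap P g x) = x by rewrite -fmap_comp gf fmap_id.
  rewrite -{2}xE -naturality -linearB; apply: (decomposable_subfunctor P).2.
  exact: rhou.
have [v wv] := projective_lift (nat_id P) pP (nakayama N0 wN).
have vN T x : decomposable (v T x - (N T)^-1 *: x).
  have /(subspaceZ (N T)^-1 (@decomposable_subspace _ _)) := wN T (v T x).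
  rewrite wv scalerBr scalerA mulVf // scale1r => Dv.
  exact: subspaceBC.
have Nv0 T : (N T)^-1 != 0 by rewrite invr_eq0.
exists (nat_comp v s) => T x.
have [y <-] := nakayama Nv0 vN x.
by have := congr1 (v T) (wv T y).
Qed.

End Decomposables.

(** * Growth *)

Section Growth.
Variables (R : realType) (k : fieldType) (U : finGroupType -> Prop).
Implicit Types (X Y P Q : functor k U) (T S E G H : ob U).

Lemma dimension_rep G T :
  dimension R (representable k G T) = (#|{: hom T G}|%:R)%:E.
Proof.
apply/eqP; rewrite eq_le; apply/andP; split.
  apply: ge_ereal_sup => _ [n [v indv] <-]; rewrite lee_fin ler_nat.
  rewrite (lin_indep_le_span (w := @rep_basis k U G T) indv) // => l.
  by exists (v l); rewrite -rep_sum.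
apply: ereal_sup_ubound; exists #|{: hom T G}| => //=.
exists (fun l => rep_basis k (enum_val l)) => c c0 l.
have /ffunP/(_ (enum_val l)) := c0.
rewrite sum_ffunE (bigD1 l) //= big1 ?addr0.
  by rewrite !ffunE eqxx => <-; rewrite [_ *: _]mulr1.
move=> j jl; rewrite !ffunE (inj_eq enum_val_inj) eq_sym (negPf jl).
by rewrite scaler0.
Qed.

(** The suprema defining omega decrease with m. *)
Lemma omega_inf (n : nat) X :
  omega R n X = ereal_inf (range (fun m : nat =>
    ereal_sup [set a : \bar R | exists2 T : ob U, rank_ge m T &
      a = (dimension R (X T) * ((n%:R ^+ delta T)^-1)%:E)%E]%classic)).
Proof.
apply: cvg_lim; first exact: ereal_hausdorff.
apply: ereal_nonincreasing_cvgn => m p mp.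
apply: le_ereal_sup => _ [T pT ->]; exists T => //.
exact: leq_trans mp pT.
Qed.

Lemma ob_card_gt0 T : (0 < #|T|)%N.
Proof. by apply/card_gt0P; exists 1%g. Qed.

Hypothesis U_complete : complete R k U.

(** A positive infimum of suprema only says that each rank bound is met by some
    T with many surjections onto G, which suffices for the contradiction. *)
Lemma card_hom_lower G : exists2 c : R, 0 < c &
  forall m, exists2 T : ob U, (m <= delta T)%N &
    c * #|G|%:R ^+ delta T <= #|{: hom T G}|%:R.
Proof.
have [] := U_complete.2 _ G (ob_card_gt0 G) erefl; rewrite omega_inf.
set I := ereal_inf _ => I0 Ioo.
have Ifin : I \is a fin_num by rewrite ge0_fin_numE // ltW.
exists (fine I / 2) => [|m]; first by rewrite divr_gt0 // fine_gt0 // I0.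
have Ilt : ((fine I / 2)%:E < I)%E.
  rewrite -[ltRHS]fineK // lte_fin ltr_pdivrMr // ltr_pMr ?ltr1n //.
  by rewrite fine_gt0 // I0.
have /ereal_sup_gt[_ [T mT ->]] :=
  lt_le_trans Ilt (ereal_inf_lbound (imageT _ m)).
rewrite dimension_rep -EFinM lte_fin.
rewrite ltr_pdivlMr ?exprn_gt0 ?ltr0n ?ob_card_gt0 //.
by move=> /ltW; exists T.
Qed.

Lemma card_hom_upper G : exists C : R, exists m : nat,
  forall T : ob U, (m <= delta T)%N ->
    #|{: hom T G}|%:R <= C * #|G|%:R ^+ delta T.
Proof.
have [] := U_complete.2 _ G (ob_card_gt0 G) erefl; rewrite omega_inf.
set I := ereal_inf _ => I0 Ioo.
have Ifin : I \is a fin_num by rewrite ge0_fin_numE // ltW.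
have : (I < (fine I + 1)%:E)%E by rewrite -[ltLHS]fineK // lte_fin ltrDl.
move=> /ereal_inf_lt[_ [m _ <-] /ltW supC].
exists (fine I + 1), m => T mT.
rewrite -ler_pdivrMr ?exprn_gt0 ?ltr0n ?ob_card_gt0 // -lee_fin EFinM.
rewrite -dimension_rep; apply: le_trans supC.
by apply: ereal_sup_ubound; exists T.
Qed.

End Growth.

Section Translates.
Variables (k : fieldType) (U : finGroupType -> Prop).
Implicit Types (X Y P Q : functor k U) (T S E G H : ob U).
Hint Resolve decomposable_subspace : core.

Lemma rep_decomposable0 G (u : representable k G G) : decomposable u -> u = 0.
Proof.
elim=> [|v S f w lt _ ->] //; rewrite add0r.
rewrite (_ : w = 0) ?linear0 //; apply/ffunP => g.
by have := hom_card_le g; rewrite leqNgt lt.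
Qed.

(** Choose a functional lam on P(G) with lam(x) = 1 that kills decomposables.
    The average of y |-> lam(y) [id] lifts to P -> e_G, and the coefficient of
    the identity in the image of x is lam(x): e_G(G) has no nonzero
    decomposables, so nothing is lost by lifting. *)
Lemma detect_indecomposable P G (x : P G) : projective P -> ~ decomposable x ->
  exists s : nat_trans P (representable k G), s G x != 0.
Proof.
move=> pP Nx.
pose S (w : P G) (c : k^o) := decomposable (w - (c : k) *: x).
have [|c w1 v1 w2 v2 D1 D2|lam lamS] := @linear_uniformization k (P G) k^o S.
- by rewrite /S scale0r subr0; constructor.
- rewrite /S (_ : _ - _ = c *: (w1 - (v1 : k) *: x) + (w2 - (v2 : k) *: x)).
    exact: (@decomposable_subspace _ _ _ _).2.
  by rewrite scalerDl scalerBr scalerA addrACA opprD.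
have scale_inj c : decomposable (c *: x) -> c = 0.
  move=> Dc; apply/eqP/negP => /negP c0; apply: Nx.
  by rewrite -[x]scale1r -(mulVf c0) -scalerA; apply: subspaceZ.
have lamx : lam x = 1.
  apply/esym/subr0_eq/scale_inj.
  have := lamS x 1; rewrite /S scale1r subrr scalerBl scale1r; apply.
  by constructor.
have lamD w : decomposable w -> lam w = 0.
  move=> Dw; apply: scale_inj; rewrite -[_ *: x](subKr w).
  by apply: subspaceB => //; apply: (lamS w 0); rewrite /S scale0r subr0.
pose e := rep_basis k (hom_id G).
have rho_lin : linear (fun y => (lam y : k) *: e).
  by move=> c y z; rewrite linearP scalerDl scalerA.
pose rho : {linear P G -> representable k G G} := linear_of rho_lin.
have [|s sE] := lift_mod_decomposable
  (c := average rho) pP (average_linear _).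
  apply: average_nat => w /lamD /= w0.
  by rewrite w0 scale0r; constructor.
exists s; apply/eqP => sx0; have /rep_decomposable0 := sE G x.
rewrite sx0 sub0r => /eqP; rewrite oppr_eq0 => /eqP /ffunP /(_ (hom_id G)).
have -> : average rho x = \sum_(p : hom G G * hom G G |
    hom_comp p.2 p.1 == hom_id G) (lam (fmap P p.2 x) : k) *: rep_basis k p.1.
  apply: eq_bigr => p _.
  by rewrite -[in RHS](hom_1comp p.1) -rep_basis_fmap -linearZ.
rewrite sum_ffunE (bigD1 (hom_id G, hom_id G)) ?hom_comp1 //=.
rewrite fmap_id lamx scale1r big1 => [|[f g] /andP[/eqP /= gf fg]].
  by rewrite !ffunE eqxx addr0 => /eqP; rewrite oner_eq0.
rewrite !ffunE; case: eqP => [f1|_]; last by rewrite scaler0.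
by move: fg gf; rewrite -f1 hom_comp1 => + gf; rewrite gf eqxx.
Qed.

(** Keep one surjection f per orbit of Out G.  The image of f^* x in e_G(T) is
    supported on the orbit of f, and it is nonzero because the action is free;
    so the kept translates are independent. *)
Lemma independent_translates P G (s : nat_trans P (representable k G)) x :
  s G x != 0 -> forall T, exists n (v : 'I_n -> hom T G),
    lin_indep (fun l => fmap P (v l) x) /\
    (#|{: hom T G}| <= n * #|{: hom G G}|)%N.
Proof.
move=> sx T.
pose orb (f g : hom T G) := [exists a : hom G G, hom_comp a f == g].
have orbI a f : orb f (hom_comp a f) by apply/existsP; exists a.
have orb_id f : orb f f by rewrite -{2}[f]hom_1comp.
have orb_sym f g : orb f g -> orb g f.
  move=> /existsP[a /eqP <-]; have [b [ba _]] := hom_inverse a erefl.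
  by apply/existsP; exists b; rewrite hom_compA ba hom_1comp.
have orb_trans f g h : orb f g -> orb g h -> orb f h.
  move=> /existsP[a /eqP <-] /existsP[b /eqP <-].
  by rewrite hom_compA.
pose rep f := odflt f [pick g | orb f g].
have orb_rep f : orb f (rep f).
  by rewrite /rep; case: pickP => // /(_ f); rewrite orb_id.
have rep_eq f g : orb f g -> rep f = rep g.
  move=> fg; rewrite /rep (@eq_pick _ (orb f) (orb g)).
    by case: pickP => // /(_ g); rewrite orb_id.
  by move=> h; apply/idP/idP; apply: orb_trans => //; apply: orb_sym.
pose A := [set f | rep f == f].
exists #|A|, enum_val; split; last first.
  rewrite -[#|{: hom T G}|]cardsT -[#|{: hom G G}|]cardsT -cardsX.
  apply: leq_trans (leq_imset_card (fun p => hom_comp p.2 p.1) _).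
  apply: subset_leq_card; apply/fintype.subsetP => f _; apply/imsetP.
  have /existsP[a /eqP af] := orb_sym _ _ (orb_rep f).
  exists (rep f, a) => //; rewrite !inE /= andbT; apply/eqP/esym/rep_eq/orb_rep.
move=> c c0 l; have [a sxa] : exists a, s G x a != 0.
  apply/existsP; apply: contraNT sx => /existsPn sx0; apply/eqP/ffunP => a.
  by have /negPn/eqP -> := sx0 a; rewrite ffunE.
have := congr1 (s T) c0; rewrite linear0 linear_sum.
move=> /ffunP/(_ (hom_comp a (enum_val l))).
rewrite sum_ffunE (bigD1 l) //= big1 ?addr0 => [|j jl].
  rewrite linearZ naturality !ffunE (big_pred1 a) => [|b]; last first.
    by apply/eqP/eqP => [/hom_comp_injl|->].
  by move=> /eqP; rewrite [_ == _]mulf_eq0 (negPf sxa) orbF => /eqP.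
rewrite linearZ naturality !ffunE big_pred0 ?scaler0 // => b.
apply/eqP => ba; move/eqP: jl; apply; apply: enum_val_inj.
have := enum_valP j; have := enum_valP l; rewrite !inE => /eqP <- /eqP <-.
by rewrite (rep_eq _ _ (orbI b _)) ba -(rep_eq _ _ (orbI a _)).
Qed.

End Translates.

Section MonoDecomposable.
Variables (R : realType) (k : fieldType) (U : finGroupType -> Prop).
Implicit Types (X Y P Q : functor k U) (T S E G H : ob U).
Hypothesis U_complete : complete R k U.

(** If y is the sum of the h_i^* z_i, then f^* y is the sum of the
    (h_i f)^* z_i, so the translates of the z_i span, and there are
    |U(T,S_i)| = O(|S_i|^delta(T)) of them. *)
Lemma decomposable_span Q G (y : Q G) : decomposable y ->
  exists (C : R) (m : nat), forall T, (m <= delta T)%N ->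
    exists (I : finType) (w : I -> Q T),
      #|I|%:R <= C * #|G|.-1%:R ^+ delta T /\
      forall f : hom T G, exists c : I -> k, fmap Q f y = \sum_i c i *: w i.
Proof.
elim=> [|x S h z lt Dx [C [m IH]]].
  exists 0, 0%N => T _; exists void, (@of_void _).
  rewrite card_void mul0r; split=> // f; exists (@of_void _).
  by rewrite linear0 big1 // => -[].
have [C' [m' up]] := card_hom_upper U_complete S.
exists (C + `|C'|), (maxn m m') => T; rewrite geq_max => /andP[mT m'T].
have [I [w [cardI wE]]] := IH T mT.
exists (I + hom T S)%type, (fun i => match i with
  inl i => w i | inr f => fmap Q f z end); split.
  rewrite card_sum natrD mulrDl lerD //.
  apply: le_trans (up T m'T) _; apply: le_trans (ler_norm _) _.
  rewrite normrM ler_wpM2l // ger0_norm ?exprn_ge0 //.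
  rewrite lerXn2r ?nnegrE ?ler0n // ler_nat.
  by rewrite -ltnS prednK // (leq_trans _ lt).
move=> f; have [c cE] := wE f.
exists (fun i => match i with
  inl i => c i | inr g => (g == hom_comp h f)%:R end).
rewrite big_sumType /= -cE linearD -fmap_comp; congr (_ + _).
rewrite (bigD1 (hom_comp h f)) //= eqxx scale1r big1 ?addr0 // => g /negPf ->.
by rewrite scale0r.
Qed.

Lemma exp_growth (c C : R) n : 0 < c -> (0 < n)%N ->
  exists m, forall d, (m <= d)%N -> C * n.-1%:R ^+ d < c * n%:R ^+ d.
Proof.
move=> c0 n0; pose q : R := n.-1%:R / n%:R.
have n0' : (0 : R) < n%:R by rewrite ltr0n.
have q0 : 0 <= q by rewrite divr_ge0.
have q1 : `|q| < 1 by rewrite ger0_norm // ltr_pdivrMr // mul1r ltr_nat prednK.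
have C0 : 0 < `|C| + 1 by rewrite ltr_wpDl.
have /cvgrPdist_lt/(_ (c / (`|C| + 1))) := cvg_expr q1.
rewrite divr_gt0 // => /(_ isT) [m _ mP]; exists m => d md.
have := mP d md; rewrite /= sub0r normrN ger0_norm ?exprn_ge0 //.
rewrite ltr_pdivlMr // mulrC expr_div_n mulrA ltr_pdivrMr ?exprn_gt0 //.
apply: le_lt_trans; rewrite ler_wpM2r ?exprn_ge0 //.
by rewrite (le_trans (ler_norm C)) // lerDl.
Qed.

(** The growth argument: independent translates of x, of which there are at
    least c |G|^delta(T) / |Out G|, remain independent under u and cannot fit
    in a space of dimension at most C (|G| - 1)^delta(T). *)
Lemma mono_reflects_decomposable P Q (u : nat_trans P Q) G (x : P G) :
  projective P -> (forall T y, u T y = 0 -> y = 0) ->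
  decomposable (u G x) -> decomposable x.
Proof.
move=> pP u_inj Dux; apply: contrapT => Nx.
have [s sx] := detect_indecomposable pP Nx.
have [C [m span]] := decomposable_span Dux.
have [c c0 low] := card_hom_lower U_complete G.
have [m' grow] := exp_growth (C * #|{: hom G G}|%:R) c0 (ob_card_gt0 G).
have [T + lowT] := low (maxn m m').
rewrite geq_max => /andP[/span[I [w [cardI wE]]] /grow].
have [n [v [indv cardv]]] := independent_translates sx T.
have nI : (n <= #|I|)%N.
  apply: (lin_indep_le_span (v := fun l => fmap Q (v l) (u G x)) (w := w)).
    move=> a a0; apply: indv; apply: u_inj; rewrite linear_sum -[RHS]a0.
    by apply: eq_bigr => l _; rewrite linearZ naturality.
  by move=> l; apply: wE.
apply/negP; rewrite -leNgt; apply: le_trans lowT _.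
apply: (@le_trans _ _ (#|I| * #|{: hom G G}|)%:R).
  by rewrite ler_nat (leq_trans cardv) // leq_mul2r nI orbT.
by rewrite natrM mulrAC ler_wpM2r.
Qed.

End MonoDecomposable.

(** * Resolutions *)

Section Resolutions.
Variables (k : fieldType) (U : finGroupType -> Prop).
Implicit Types (X Y P Q : functor k U) (T S E G H : ob U).

Definition nat_zero X Y : nat_trans X Y :=
  nat_sub (nat_sum (@of_void (nat_trans X Y))) (nat_sum (@of_void _)).

Lemma zero_projective X : is_zero X -> projective X.
Proof.
move=> X0 A B p f _; exists (nat_zero X A) => T x.
by rewrite (X0 T x) !linear0.
Qed.

(** The cokernels K i of the differentials are projective by descending
    induction, from those that vanish. *)
Lemma finite_resolution_projective
    (mono_splits : forall P Q (u : nat_trans P Q),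
       projective P -> projective Q -> (forall T x, u T x = 0 -> x = 0) ->
       exists r : nat_trans Q P, forall T x, r T (u T x) = x) X :
  has_finite_projective_resolution X -> projective X.
Proof.
move=> [C [d [aug [[/epimorphismP aug_surj aug_ex d_ex [N C0]] pC]]]].
pose K i := quot_functor (image_subfunctor (d i)).
pose pi i : nat_trans (C i) (K i) := quot_nat (image_subfunctor (d i)).
have pi_surj i : surjective_nat (pi i) by move=> T z; apply: quot_nat_surj.
have pi0 i T x : pi i T x = 0 <-> exists y, d i T y = x by apply: quot_nat0.
have stepK i : projective (K i.+1) -> projective (K i).
  move=> pK.
  have [m mE] : exists m : nat_trans (K i.+1) (C i),
      forall T x, m T (pi i.+1 T x) = d i T x.
    by apply: factor_through_surj => // T x /pi0 /d_ex.
  have [|r rm] := mono_splits _ _ m pK (pC i).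
    move=> T z; have [x <-] := pi_surj i.+1 T z.
    by rewrite mE => /d_ex dx; apply/pi0.
  (* 1 - m r kills im (d i) = im m, and is the identity modulo that image. *)
  have [sec secE] : exists s : nat_trans (K i) (C i),
      forall T x, s T (pi i T x) = x - m T (r T x).
    apply: (factor_through_surj (n := nat_sub (nat_id _) (nat_comp m r))) => //.
    move=> T _ /pi0[y <-].
    by rewrite -mE /= rm; apply: subrr.
  apply: (projective_retract (i := sec) (p := pi i)) (pC i) => T z.
  have [x <-] := pi_surj i T z; rewrite secE linearB.
  have [y <-] := pi_surj i.+1 T (r T x).
  by rewrite mE (pi0 i T (d i T y)).2 ?subr0 //; exists y.
have pK n i : (N <= i + n)%N -> projective (K i).
  elim: n i => [|n IH] i; last by rewrite addnS -addSn => /IH /stepK.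
  rewrite addn0 => /C0 Ci0; apply: zero_projective => T z.
  by have [x <-] := pi_surj i T z; rewrite (Ci0 T x) linear0.
have [q qE] : exists q : nat_trans (K 0%N) X,
    forall T x, q T (pi 0%N T x) = aug T x.
  by apply: factor_through_surj => // T x /pi0 /aug_ex.
have [j jE] : exists j : nat_trans X (K 0%N),
    forall T x, j T (aug T x) = pi 0%N T x.
  by apply: factor_through_surj => // T x /aug_ex /pi0.
apply: (projective_retract (i := j) (p := q)) (pK N 0%N (leqnn _)) => T x.
by have [y <-] := aug_surj T x; rewrite jE qE.
Qed.

End Resolutions.

(** * Finite sums of indecomposable projectives *)

Section FinitelyProjective.
Variables (k : fieldType) (U : finGroupType -> Prop).
Implicit Types (X Y P Q : functor k U) (T S E G H : ob U).

Lemma direct_sum_projective (I : finType) (P : I -> functor k U) X :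
  is_direct_sum P X -> (forall i, projective (P i)) -> projective X.
Proof.
move=> [inj [proj [_ _ sumX]]] pP A B q f epi.
have g_ex i : exists g : nat_trans (P i) A,
    forall T x, q T (g T x) = nat_comp f (inj i) T x by apply: pP.
pose g i := projT1 (cid (g_ex i)).
have gE i T x : q T (g i T x) = f T (inj i T x) by rewrite /g; case: cid.
exists (nat_sum (fun i => nat_comp (g i) (proj i))) => T x.
rewrite /= linear_sum -[in RHS](sumX T x) linear_sum.
by apply: eq_bigr => i _; apply: gE.
Qed.

Lemma direct_sum_trans (I : finType) (J : I -> finType) (P : I -> functor k U)
    (Q : forall i, J i -> functor k U) X :
  is_direct_sum P X -> (forall i, is_direct_sum (@Q i) (P i)) ->
  is_direct_sum (fun p : {i : I & J i} => Q (tag p) (tagged p)) X.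
Proof.
move=> [inj [proj [pi1 pi0 sumX]]] dsP.
pose inj' i := projT1 (cid (dsP i)).
have [proj' dsP'] : exists proj' : forall i j, nat_trans (P i) (Q i j),
  forall i, [/\ forall j T x, proj' i j T (inj' i j T x) = x,
    forall j l T x, j != l -> proj' i l T (inj' i j T x) = 0
    & forall T x, \sum_j inj' i j T (proj' i j T x) = x].
  exists (fun i => projT1 (cid (projT2 (cid (dsP i))))) => i.
  by rewrite /inj'; case: cid => /= a b; case: cid.
exists (fun p => nat_comp (inj (tag p)) (inj' (tag p) (tagged p))).
exists (fun p => nat_comp (proj' (tag p) (tagged p)) (proj (tag p))).
split=> [[i j] T x|[i j] [i' j'] T x|T x] /=.
- by rewrite pi1; have [-> _ _] := dsP' i.
- have [E|ii' _] := eqVneq i i'; last by rewrite pi0 ?linear0.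
  subst i'; rewrite pi1 => jj'; have [_ -> //] := dsP' i.
  by apply: contraNneq jj' => ->.
rewrite -[RHS]sumX -(sig_big_dep xpredT (fun _ => xpredT) (fun i j =>
  inj i T (inj' i j T (proj' i j T (proj i T x))))) /=.
by apply: eq_bigr => i _; rewrite -linear_sum; have [_ _ ->] := dsP' i.
Qed.

Lemma direct_sum_reindex (I : finType) (P : I -> functor k U) X :
  is_direct_sum P X ->
  is_direct_sum (fun l : 'I_#|I| => P (enum_val l)) X.
Proof.
move=> [inj [proj [pi1 pi0 sumX]]].
exists (fun l => inj (enum_val l)), (fun l => proj (enum_val l)).
split=> [l|l l' T x ll'|T x]; first exact: pi1.
  by apply: pi0; rewrite (inj_eq enum_val_inj).
by rewrite -[RHS]sumX [RHS](reindex _ (onW_bij _ (enum_val_bij I))).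
Qed.

Lemma kernel_subfunctor X Y (p : nat_trans X Y) :
  subfunctor (fun T x => p T x = 0).
Proof.
split=> [T|T S f x x0]; last by rewrite naturality x0 linear0.
split=> [|c x y x0 y0]; first by rewrite linear0.
by rewrite linearP x0 y0 scaler0 addr0.
Qed.

(** The kernels of e and 1 - e give a direct sum decomposition, in which the
    image of e is realized as the quotient by the kernel of e. *)
Lemma indecomposable_idempotent P (e : nat_trans P P) :
  indecomposable P -> (forall T x, e T (e T x) = e T x) ->
  (forall T x, e T x = 0) \/ (forall T x, e T x = x).
Proof.
move=> [_ indP] ee.
pose c (b : bool) := if b then e else nat_sub (nat_id P) e.
have cc b T x : c b T (c b T x) = c b T x.
  by case: b => /=; rewrite ?ee // linearB ee subrr subr0.
have cN b T x : c (~~ b) T (c b T x) = 0.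
  by case: b => /=; rewrite ?linearB ee subrr.
pose Q b := quot_functor (kernel_subfunctor (c b)).
pose q b : nat_trans P (Q b) := quot_nat (kernel_subfunctor (c b)).
have q0 b T x : q b T x = 0 <-> c b T x = 0 by apply: quot_nat0.
have i_ex b : exists i : nat_trans (Q b) P, forall T x, i T (q b T x) = c b T x.
  apply: factor_through_surj => [T z|T x /q0 //]; exact: quot_nat_surj.
pose i b := projT1 (cid (i_ex b)).
have iE b T x : i b T (q b T x) = c b T x by rewrite /i; case: cid.
have ds : is_direct_sum Q P.
  exists i, q; split=> [b T z|b b' T z bb'|T x].
  - have [x <-] := quot_nat_surj z; rewrite -/(q b T x) iE.
    by apply/quot_natP; rewrite linearB cc subrr.
  - have [x <-] := quot_nat_surj z; rewrite -/(q b T x) iE; apply/q0.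
    by rewrite (_ : b' = ~~ b) ?cN //; case: b b' bb' {z x} => [] [].
  - by rewrite big_bool !iE /= addrC subrK.
have zQ b : is_zero (Q b) -> forall T x, c b T x = 0.
  by move=> z T x; apply/q0/z.
case: (indP Q ds) => /zQ c0; [left=> T x | right=> T x]; first exact: c0.
by apply/esym/subr0_eq/c0.
Qed.

(** On a group G of least order with P(G) <> 0 nothing is decomposable.  Let
    b : e_G -> P be given by some nonzero x, and rho a linear generalized
    inverse of b on G.  The average of rho lifts to s : P -> e_G, and
    b s b = N b with N = |Out G|; so b s / N is a nonzero idempotent of P, hence
    the identity. *)
Lemma indecomposable_projective_retract P :
  [pchar k] =i pred0 -> indecomposable P -> projective P ->
  exists G (a : nat_trans P (representable k G))
    (b : nat_trans (representable k G) P), forall T x, b T (a T x) = x.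
Proof.
move=> char0 indP pP.
have [G [x [x0 min]]] : exists G (x : P G), x <> 0 /\
    forall S (y : P S), (#|S| < #|G|)%N -> y = 0.
  apply: contrapT => Nex; apply: indP.1 => T.
  have [n] := ubnP #|T|; elim: n T => // n IH T leTn x.
  apply: contrapT => x0; apply: Nex; exists T, x; split=> // S y lt.
  exact: IH (leq_trans lt leTn) y.
have dec0 (y : P G) : decomposable y -> y = 0.
  elim=> [//|z S f w lt _ ->]; by rewrite (min S w lt) linear0 addr0.
pose b := yoneda x.
have [||rho rhoP] := @linear_uniformization k (P G) (representable k G G)
  (fun w v => w = b G v).
- by rewrite linear0.
- by move=> c w1 v1 w2 v2 -> ->; rewrite linearP.
have [|s sE] := lift_mod_decomposable (c := average rho) pP (average_linear _).
  by apply: average_nat => y /dec0 ->; rewrite linear0; constructor.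
pose N : k := #|[pred p : hom G G * hom G G |
  hom_comp p.2 p.1 == hom_id G]|%:R.
have N0 : N != 0.
  rewrite ((pcharf0P k).1 char0) -lt0n card_ob_pair_gt0 //.
  exact: isomorphic_refl.
have bsb T u : b T (s T (b T u)) = N *: b T u.
  apply: (nat_rep_ext (n := nat_comp b (nat_comp s b)) (m := nat_scale N b)).
  set z := rep_basis _ _; suff : b G (s G (b G z)) = N *: b G z by [].
  have /subr0_eq -> := rep_decomposable0 (sE G (b G z)).
  rewrite linear_sum scaler_nat -sumr_const; apply: eq_bigr => p /eqP gf.
  rewrite naturality -(rhoP _ _ (esym (naturality b p.2 z))).
  by rewrite -fmap_comp gf fmap_id.
pose e := nat_scale N^-1 (nat_comp b s).
have eE T y : e T y = N^-1 *: b T (s T y) by [].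
have [|e0|e1] := @indecomposable_idempotent _ e indP.
- move=> T y; rewrite !eE [s T _]linearZ_LR [b T _]linearZ_LR bsb.
  by rewrite (scalerA N^-1 N) mulVf // scale1r.
- case: x0; have := e0 G x; rewrite eE -[x in s G x]fmap_id -yonedaE bsb.
  by rewrite scalerA mulVf // scale1r yonedaE fmap_id.
exists G, (nat_scale N^-1 s), b => T y.
by rewrite -[RHS]e1 eE -linearZ_LR.
Qed.

Section FinitelyGenerated.
Variables (I : finType) (G : I -> ob U).

Definition retract_of_free Y : Prop :=
  exists (a : forall i, nat_trans Y (representable k (G i)))
    (b : forall i, nat_trans (representable k (G i)) Y),
    forall T y, \sum_i b i T (a i T y) = y.

(** The sum of the dimensions of the Y (G i) is at most d, in a form that makes
    sense without assuming these dimensions finite. *)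
Definition rank_le Y (d : nat) : Prop :=
  forall nu : I -> nat,
    (forall i, exists v : 'I_(nu i) -> Y (G i), lin_indep v) ->
    (\sum_i nu i <= d)%N.

Lemma retract_of_free_retract X Y (i : nat_trans Y X) (p : nat_trans X Y) :
  (forall T y, p T (i T y) = y) -> retract_of_free X -> retract_of_free Y.
Proof.
move=> pi [a [b ab]].
exists (fun j => nat_comp (a j) i), (fun j => nat_comp p (b j)) => T y.
by rewrite -linear_sum ab pi.
Qed.

Lemma retract_of_free_rank Y : retract_of_free Y -> exists d, rank_le Y d.
Proof.
move=> [a [b ab]].
exists (\sum_i #|{: {j : I & hom (G i) (G j)}}|)%N => nu nuP.
apply: leq_sum => i _; have [v indv] := nuP i.
apply: (lin_indep_le_span
  (w := fun p => b (tag p) (G i) (rep_basis k (tagged p))) indv) => l.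
exists (fun p => a (tag p) (G i) (v l) (tagged p)).
rewrite -[LHS]ab -(sig_big_dep xpredT (fun _ => xpredT) (fun j f =>
  a j (G i) (v l) f *: b j (G i) (rep_basis k f))) /=.
apply: eq_bigr => j _; rewrite [X in b j _ X]rep_sum linear_sum.
by apply: eq_bigr => f _; rewrite linearZ_LR.
Qed.

Lemma retract_of_free_zero Y : retract_of_free Y ->
  (forall i (y : Y (G i)), y = 0) -> is_zero Y.
Proof.
move=> [a [b ab]] Y0 T y; rewrite -[y]ab big1 // => i _.
rewrite [X in b i _ X]rep_sum linear_sum big1 // => f _.
by rewrite linearZ_LR nat_rep_basis [X in fmap Y f X]Y0 linear0 scaler0.
Qed.

(** The other summand is nonzero, hence nonzero on some G i, and a vector found
    there can be added to any independent family coming from P c. *)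
Lemma rank_le_summand (P : bool -> functor k U) Y d (c : bool) :
  is_direct_sum P Y -> retract_of_free (P (~~ c)) -> ~ is_zero (P (~~ c)) ->
  rank_le Y d -> (0 < d)%N /\ rank_le (P c) d.-1.
Proof.
move=> [inj [proj [pi1 pi0 _]]] free nz rkY.
have [i [y y0]] : exists i (y : P (~~ c) (G i)), y <> 0.
  apply: contrapT => Nex; apply: nz; apply: retract_of_free_zero => // i y.
  by apply: contrapT => y0; apply: Nex; exists i, y.
suff lt nu : (forall j, exists v : 'I_(nu j) -> P c (G j), lin_indep v) ->
    (\sum_j nu j < d)%N.
  have d0 : (0 < d)%N.
    apply: leq_ltn_trans (leq0n _) (lt (fun _ => 0%N) _) => j.
    by exists (fun _ => 0) => c' _ [].
  by split=> // nu /lt ltd; rewrite -ltnS prednK.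
move=> nuP; have := rkY (fun j => nu j + (j == i))%N.
have -> : (\sum_j (nu j + (j == i)) = (\sum_j nu j).+1)%N.
  rewrite big_split /= -addn1; congr (_ + _)%N.
  by rewrite (bigD1 i) //= eqxx big1 // => j /negPf ->.
apply=> j; have [v indv] := nuP j; have [E|_] := eqVneq j i; last first.
  rewrite addn0; exists (fun l => inj c (G j) (v l)) => a a0; apply: indv.
  have := congr1 (proj c (G j)) a0; rewrite linear0 linear_sum => pa0.
  by rewrite -[RHS]pa0; apply: eq_bigr => l _; rewrite linearZ_LR pi1.
subst j; rewrite addn1.
exists (fun l => if unlift ord0 l is Some l' then inj c (G i) (v l')
                 else inj (~~ c) (G i) y) => a.
rewrite big_ord_recl unlift_none; under eq_bigr do rewrite liftK.
move=> a0; have cc : c != ~~ c by case: (c).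
have a00 : a ord0 = 0.
  have := congr1 (proj (~~ c) (G i)) a0.
  rewrite linear0 linearD linear_sum linearZ_LR pi1.
  rewrite big1 ?addr0 => [ay|l _]; last first.
    by rewrite linearZ_LR pi0 ?scaler0.
  by move/eqP: ay; rewrite scaler_eq0 => /orP[] /eqP.
have aS : forall l, a (lift ord0 l) = 0.
  apply: indv; have := congr1 (proj c (G i)) a0.
  rewrite a00 scale0r add0r linear0 linear_sum => pa0.
  by rewrite -[RHS]pa0; apply: eq_bigr => l _; rewrite linearZ_LR pi1.
by move=> l; case: (unliftP ord0 l) => [l'|] ->.
Qed.

(** As long as Y is not indecomposable, it splits into two nonzero summands of
    smaller rank. *)
Lemma rank_le_decompose d Y :
  projective Y -> retract_of_free Y -> rank_le Y d ->
  exists (J : finType) (P : J -> functor k U),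
    (forall j, indecomposable (P j) /\ projective (P j)) /\ is_direct_sum P Y.
Proof.
elim/ltn_ind: d Y => d IH Y pY freeY rkY.
have [Y0|nzY] := pselect (is_zero Y).
  exists void, (@of_void _); split=> [[]|].
  exists (fun i : void => match i with end), (fun i : void => match i with end).
  by split=> [[]|[]|T y]; rewrite big1 ?(Y0 T y) // => -[].
have [indY|] := pselect (indecomposable Y).
  exists unit, (fun _ => Y); split=> //.
  exists (fun _ => nat_id Y), (fun _ => nat_id Y); split=> // T x.
  by rewrite big_const card_unit /= addr0.
move=> /not_andP[//|/existsNP[P /not_implyP[ds /not_orP[nzt nzf]]]].
have nz b : ~ is_zero (P b) by case: b.
have [inj [proj [pi1 pi0 sumY]]] := ds.
have free b : retract_of_free (P b).
  exact: (retract_of_free_retract (i := inj b) (p := proj b)).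
have pP b : projective (P b).
  exact: (projective_retract (i := inj b) (p := proj b)).
have ex b : exists (J : finType) (Q : J -> functor k U),
    (forall j, indecomposable (Q j) /\ projective (Q j)) /\
    is_direct_sum Q (P b).
  have [d0 rkP] := rank_le_summand ds (free (~~ b)) (nz (~~ b)) rkY.
  by apply: (IH d.-1) => //; rewrite prednK.
pose J b := projT1 (cid (ex b)).
pose Q b : J b -> functor k U := projT1 (cid (projT2 (cid (ex b)))).
have QP b : (forall j, indecomposable (@Q b j) /\ projective (@Q b j)) /\
    is_direct_sum (@Q b) (P b).
  exact: projT2 (cid (projT2 (cid (ex b)))).
exists {b : bool & J b}, (fun p => Q (tag p) (tagged p)); split.
  by move=> [b j]; apply: (QP b).1.
exact: direct_sum_trans ds (fun b => (QP b).2).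
Qed.

End FinitelyGenerated.

Lemma perfect_finitely_projective X :
  [pchar k] =i pred0 -> projective X -> perfect X -> finitely_projective X.
Proof.
move=> char0 pX [C [d [aug [[epi_aug _ _ _] fpC]]]].
have [sec secE] := pX _ _ aug (nat_id X) epi_aug.
have [n [P [indP ds]]] := fpC 0%N.
have ret i := indecomposable_projective_retract char0 (indP i).1 (indP i).2.
pose G i := projT1 (cid (ret i)).
have free : retract_of_free G (C 0%N).
  have a_ex i := projT2 (cid (ret i)).
  pose a i := projT1 (cid (a_ex i)).
  pose b i := projT1 (cid (projT2 (cid (a_ex i)))).
  have ba i T x : b i T (a i T x) = x.
    exact: projT2 (cid (projT2 (cid (a_ex i)))) T x.
  have [inj [proj [_ _ sumC]]] := ds.
  exists (fun i => nat_comp (a i) (proj i)), (fun i => nat_comp (inj i) (b i)).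
  by move=> T y; rewrite -[RHS]sumC; apply: eq_bigr => i _; rewrite /= ba.
have freeX := retract_of_free_retract (i := sec) (p := aug) secE free.
have [r rkX] := retract_of_free_rank freeX.
have [J [Q [indQ /direct_sum_reindex dsQ]]] := rank_le_decompose pX freeX rkX.
by exists #|J|, (fun l => Q (enum_val l)).
Qed.

End FinitelyProjective.

Theorem proposition11p6 (R : realType) (k : fieldType)
    (hk : [pchar k]%R =i pred0) (U : finGroupType -> Prop)
    (hU : replete U) (hcomplete : complete R k U) :
  (forall X : functor k U,
     has_finite_projective_resolution X -> projective X) /\
  (forall X : functor k U, perfect X -> finitely_projective X).
Proof.
have projectiveX (X : functor k U) :
    has_finite_projective_resolution X -> projective X.
  apply: finite_resolution_projective => P Q u pP pQ u_inj.
  apply: split_mono => // T x.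
  exact: (mono_reflects_decomposable hcomplete).
split=> // X perfX; apply: perfect_finitely_projective => //.
apply: projectiveX; have [C [d [aug [res fpC]]]] := perfX.
exists C, d, aug; split=> // i; have [n [P [indP ds]]] := fpC i.
by apply: direct_sum_projective ds _ => j; have [] := indP j.
Qed.
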